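(* Let $m,n\ge 1$, $\mathbb{A}=(A_1,\dots,A_n)\in\mathbb{P}_m^n$ and $\omega=(w_1,\dots,w_n)\in\Delta_n$, and let $\lambda_{M} = \max \{ \lambda_{1}(A_{j}): 1 \leq j \leq n \}$. Let $0 < t \leq z < 1$. Then $$\mathcal{R}_{t,z}(\omega; \mathbb{A})^{\frac{1-t}{2}} \geq \lambda_{M}^{-\frac{(1-t)(1-z)}{2z}} \sum_{j=1}^{n} w_{j} A_{j}^{\frac{1-t}{2z}}.$$
   Context: $\mathbb{P}_m$ is the set of $m\times m$ complex Hermitian positive definite matrices; $\ge$ is the Loewner order ($A\ge B$ iff $A-B$ is positive semidefinite); $\lambda_1(A)$ is the largest eigenvalue of $A$. $\Delta_n$ is the set of positive probability vectors $\omega=(w_1,\dots,w_n)$, i.e. $w_j>0$ and $\sum_j w_j=1$. For $0<t\le z<1$, the Rényi power mean $\mathcal{R}_{t,z}(\omega;\mathbb{A})$ is the unique $X\in\mathbb{P}_m$ satisfying $X=\sum_{j=1}^n w_j\left(A_j^{\frac{1-t}{2z}}X^{\frac{t}{z}}A_j^{\frac{1-t}{2z}}\right)^z$ (existence and uniqueness are known). *)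

(* Defs.v *)
From HB Require Import structures.
From mathcomp Require Import all_boot all_order all_algebra.
From mathcomp Require Import complex.
From mathcomp Require Import all_classical all_reals all_analysis.

Set Implicit Arguments.
Unset Strict Implicit.
Unset Printing Implicit Defensive.

Import Order.TTheory GRing.Theory Num.Theory.

Local Open Scope classical_set_scope.
Local Open Scope complex_scope.
Local Open Scope sesquilinear_scope.
Local Open Scope ring_scope.

Section HermitianMatrices.
Variables (R : realType) (m : nat).
Implicit Types (A B X : 'M[R[i]]_m).

(* In R[i], [0 < c] and [0 <= c] include the assertion that c is real. *)
Definition posdefmx A : Prop :=
  A \is hermsymmx /\
  forall x : 'cV[R[i]]_m, x != 0 -> 0 < (x ^t* *m A *m x) 0 0.

Definition psdmx A : Prop :=
  A \is hermsymmx /\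
  forall x : 'cV[R[i]]_m, 0 <= (x ^t* *m A *m x) 0 0.

Definition loewner_ge A B : Prop := psdmx (A - B).

(* Functional calculus through the unitary diagonalization
   A = U^-1 diag(d) U, with U = spectralmx A and d = spectral_diag A.
   Meaningful for positive definite A, whose d is real and positive. *)
Definition mxpow A (p : R) : 'M[R[i]]_m :=
  invmx (spectralmx A)
  *m diag_mx (map_mx (fun c : R[i] => (complex.Re c `^ p)%:C) (spectral_diag A))
  *m spectralmx A.

(* For m > 0 and A Hermitian the set of eigenvalues is finite and nonempty, so
   that this supremum is a maximum. *)
Definition lambda1 A : R := sup [set a : R | eigenvalue A a%:C].

End HermitianMatrices.

Section RenyiPowerMean.
Variables (R : realType) (m n : nat).

Definition pos_prob_vector (w : 'I_n -> R) : Prop :=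
  (forall j, 0 < w j) /\ \sum_(j < n) w j = 1.

(* The default value 0 is irrelevant when n > 0 and every [A j] is positive
   definite, since then [0 < lambda1 (A j)]. *)
Definition lambda_max (A : 'I_n -> 'M[R[i]]_m) : R :=
  \big[Num.max/0]_(j < n) lambda1 (A j).

(* X = R_{t,z}(w; A): the defining equation has exactly one positive definite
   solution when 0 < t <= z < 1. *)
Definition is_renyi_power_mean (t z : R) (w : 'I_n -> R)
    (A : 'I_n -> 'M[R[i]]_m) (X : 'M[R[i]]_m) : Prop :=
  posdefmx X /\
  X = \sum_(j < n) (w j)%:C *:
        mxpow (mxpow (A j) ((1 - t) / (2 * z)) *m mxpow X (t / z)
               *m mxpow (A j) ((1 - t) / (2 * z))) z.

End RenyiPowerMean.

(* Main.v *)
Require Import Defs.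
From HB Require Import structures.
From mathcomp Require Import all_boot all_order all_algebra.
From mathcomp Require Import complex.
From mathcomp Require Import all_classical all_reals all_analysis.
From mathcomp Require Import ring lra.

(** Let a = (1 - t) / (2 z), let S = sum_j w_j A_j^a and let L be the largest
    of the eigenvalues of the A_j.  The matrix K = A_j^a satisfies
    K^2 <= L^(2 a), so Hansen's inequality for the operator concave function
    x |-> x^z, rescaled from contractions to K, gives
        (A_j^a X^(t/z) A_j^a)^z >= L^(2 a (z - 1)) A_j^a X^t A_j^a.
    Averaging over j and using the equation that defines X, together with the
    operator convexity of B |-> B X^t B, one gets
        X >= k^2 S X^t S,  where k = L^(- (1 - t) (1 - z) / (2 z))
    ([renyi_mean_ge]).  Conjugating by X^(t/2) makes both sides squares:
        (X^((1 + t)/2))^2 >= (k X^(t/2) S X^(t/2))^2.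
    The square root is operator monotone ([psd_sqr_le]), and conjugating the
    resulting inequality by X^(-t/2) gives the claim ([loewner_sqrt]).

    Hansen's inequality K^* Y^z K <= B^z, for B = K^* Y K with K a contraction
    and 0 <= z <= 1, has a proof without integral representations ([hansen]).
    It is clear for z = 0 and z = 1.  If it holds for p and q, then
    Y^(p/2) K B^(-p/2) and Y^(q/2) K B^(-q/2) are contractions; the adjoint of
    the first times the second is similar to a Hermitian matrix whose being at
    most 1 is the inequality for (p + q) / 2 ([hansen_midpoint]).  So it holds
    on a dense subset of [0, 1], and then everywhere by continuity. *)

Set Implicit Arguments.
Unset Strict Implicit.
Unset Printing Implicit Defensive.

Import Order.TTheory GRing.Theory Num.Theory.
Import numFieldNormedType.Exports.

Local Open Scope complex_scope.
Local Open Scope ring_scope.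

Section PositiveMatrices.
Local Open Scope sesquilinear_scope.
Context {R : realType} {m : nat}.
Implicit Types (A B C D G H K N P Q S T U V X Y : 'M[R[i]]_m) (d : 'rV[R]_m)
  (u v x : 'cV[R[i]]_m) (p q r z : R).

(** * Conjugate transposes *)

Lemma trmxC_mul (k l n : nat) (A : 'M[R[i]]_(k, l)) (B : 'M[R[i]]_(l, n)) :
  (A *m B)^t* = B^t* *m A^t*.
Proof. by rewrite trmx_mul map_mxM. Qed.

Lemma trmxCD (k l : nat) (A B : 'M[R[i]]_(k, l)) : (A + B)^t* = A^t* + B^t*.
Proof. by rewrite linearD map_mxD. Qed.

Lemma trmxCB (k l : nat) (A B : 'M[R[i]]_(k, l)) : (A - B)^t* = A^t* - B^t*.
Proof. by rewrite linearB map_mxB. Qed.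

Lemma conjC_real_complex r : (r%:C)^* = r%:C :> R[i].
Proof. by apply/CrealP/complex_realP; exists r. Qed.

Lemma trmxC_realZ (k l : nat) r (A : 'M[R[i]]_(k, l)) :
  (r%:C *: A)^t* = r%:C *: A^t*.
Proof. by rewrite linearZ map_mxZ /= conjC_real_complex. Qed.

Lemma trmxC1 : (1%:M : 'M[R[i]]_m)^t* = 1%:M.
Proof. by rewrite trmx1 map_mx1. Qed.

Lemma hermsymmxP A : reflect (A^t* = A) (A \is hermsymmx).
Proof.
rewrite is_hermitianmxE expr0 scale1r eq_sym; exact: eqP.
Qed.

Lemma congr_herm C A : A^t* = A -> (C^t* *m A *m C)^t* = C^t* *m A *m C.
Proof. by move=> hA; rewrite !trmxC_mul trmxCK hA mulmxA. Qed.

Lemma herm_sum (n : nat) (w : 'I_n -> R) (B : 'I_n -> 'M[R[i]]_m) :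
  (forall j, (B j)^t* = B j) ->
  (\sum_j (w j)%:C *: B j)^t* = \sum_j (w j)%:C *: B j.
Proof.
move=> hB; rewrite (raddf_sum trmx) (raddf_sum (map_mx _)) /=.
by apply: eq_bigr => j _; rewrite trmxC_realZ hB.
Qed.

Lemma entryB (M N : 'M[R[i]]_1) : (M - N) 0 0 = M 0 0 - N 0 0.
Proof. by rewrite !mxE. Qed.

Lemma entryZ (c : R[i]) (M : 'M[R[i]]_1) : (c *: M) 0 0 = c * M 0 0.
Proof. by rewrite mxE. Qed.

(** * Positive semidefinite matrices and the Loewner order *)

Lemma sqnorm_ge0 x : 0 <= (x^t* *m x) 0 0.
Proof.
by rewrite mxE sumr_ge0 // => i _; rewrite !mxE mulrC mul_conjC_ge0.
Qed.

Lemma sqnorm_gt0 x : x != 0 -> 0 < (x^t* *m x) 0 0.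
Proof.
move=> x0; rewrite lt_neqAle sqnorm_ge0 andbT eq_sym.
apply: contra x0; rewrite mxE psumr_eq0 => [/allP x0|i _]; last first.
  by rewrite !mxE mulrC mul_conjC_ge0.
apply/eqP/colP => i; have := x0 i (mem_index_enum _); rewrite !mxE /=.
by rewrite mulrC mul_conjC_eq0 => /eqP.
Qed.

Lemma posdef_psd A : posdefmx A -> psdmx A.
Proof.
case=> hA pA; split=> // x; have [->|x0] := eqVneq x 0; last exact/ltW/pA.
by rewrite mulmx0 mxE.
Qed.

Lemma psd_congr C A : psdmx A -> psdmx (C^t* *m A *m C).
Proof.
case=> /hermsymmxP hA pA; split=> [|x].
  by apply/hermsymmxP; rewrite !trmxC_mul trmxCK hA mulmxA.
by have := pA (C *m x); rewrite trmxC_mul !mulmxA.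
Qed.

Lemma posdef_congr C A :
  C \in unitmx -> posdefmx A -> posdefmx (C^t* *m A *m C).
Proof.
move=> uC pdA; split; first by case: (psd_congr C (posdef_psd pdA)).
move=> x x0; have [_ pA] := pdA.
have Cx0 : C *m x != 0.
  by apply: contraNneq x0 => Cx0; rewrite -(mulKmx uC x) Cx0 mulmx0.
by have := pA _ Cx0; rewrite trmxC_mul !mulmxA.
Qed.

Lemma psd0 : psdmx (0 : 'M[R[i]]_m).
Proof.
split=> [|x]; first by apply/hermsymmxP; rewrite trmx0 map_mx0.
by rewrite mulmx0 mul0mx mxE.
Qed.

Lemma psdD A B : psdmx A -> psdmx B -> psdmx (A + B).
Proof.
move=> [/hermsymmxP hA pA] [/hermsymmxP hB pB]; split=> [|x].
  by apply/hermsymmxP; rewrite trmxCD hA hB.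
by rewrite mulmxDr mulmxDl mxE addr_ge0.
Qed.

Lemma psdZ r A : 0 <= r -> psdmx A -> psdmx (r%:C *: A).
Proof.
move=> r0 [/hermsymmxP hA pA]; split=> [|x].
  by apply/hermsymmxP; rewrite trmxC_realZ hA.
by rewrite -scalemxAr -scalemxAl mxE mulr_ge0 ?ler0c.
Qed.

Lemma psd_sum (n : nat) (F : 'I_n -> 'M[R[i]]_m) :
  (forall j, psdmx (F j)) -> psdmx (\sum_j F j).
Proof.
by move=> pF; apply: big_ind => [||j _]; [exact: psd0|exact: psdD|exact: pF].
Qed.

Lemma loewner_ge_trans B A C :
  loewner_ge A B -> loewner_ge B C -> loewner_ge A C.
Proof. by move=> AB /(psdD AB); rewrite addrA subrK. Qed.

Lemma loewner_conj_inv N P Q : P^t* = P -> P *m Q = 1%:M ->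
  psdmx (1%:M - Q *m N *m Q) -> loewner_ge (P *m P) N.
Proof.
move=> hP PQ /(psd_congr P); rewrite hP mulmxBr mulmxBl mulmx1.
by rewrite !mulmxA PQ mul1mx -mulmxA (mulmx1C PQ) mulmx1.
Qed.

(** * Spectral decomposition *)

Definition udiag U d : 'M[R[i]]_m :=
  U^t* *m diag_mx (map_mx (real_complex R) d) *m U.

Lemma udiag_herm U d : (udiag U d)^t* = udiag U d.
Proof.
rewrite /udiag !trmxC_mul trmxCK mulmxA; congr (_ *m _ *m _).
apply/matrixP => i j; rewrite !mxE rmorphMn /= conjC_real_complex eq_sym.
by case: eqP => // ->.
Qed.

Lemma unitarymxPV U : U \is unitarymx -> U^t* *m U = 1%:M.
Proof. by move/unitarymxP/mulmx1C. Qed.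

Lemma udiagM U d d' : U \is unitarymx ->
  udiag U d *m udiag U d' = udiag U (\row_i (d 0 i * d' 0 i)).
Proof.
move=> uU; rewrite /udiag !mulmxA (mulmxtVK _ uU) -[_ *m _ *m diag_mx _]mulmxA.
rewrite mulmx_diag.
suff -> : map_mx (real_complex R) (\row_i (d 0 i * d' 0 i)) = \row_i
  (map_mx (real_complex R) d 0 i * map_mx (real_complex R) d' 0 i) by [].
by apply/rowP => i; rewrite !mxE rmorphM.
Qed.

Lemma udiagB U d d' : udiag U d - udiag U d' = udiag U (d - d').
Proof.
rewrite /udiag map_mxB linearB /=; move: (diag_mx _) (diag_mx _) => D D'.
by rewrite mulmxBr mulmxBl.
Qed.

Lemma udiagZ r U d : r%:C *: udiag U d = udiag U (r *: d).
Proof. by rewrite /udiag map_mxZ linearZ /= -scalemxAr -scalemxAl. Qed.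

Lemma udiag1 U : U \is unitarymx -> udiag U (const_mx 1) = 1%:M.
Proof.
move=> uU; rewrite /udiag map_const_mx /= diag_const_mx mulmx1.
exact: unitarymxPV.
Qed.

(** The weights, the squared moduli of the coordinates of U x, do not depend
    on d: for fixed x the form is a linear function of the spectrum, so that
    its sign and its dependence on an exponent are read off from real sums. *)
Lemma udiag_form U x : exists2 c : 'I_m -> R, (forall i, 0 <= c i) &
  forall d, (x^t* *m udiag U d *m x) 0 0 = (\sum_i d 0 i * c i)%:C.
Proof.
have [y yE] : exists y, y = U *m x by exists (U *m x).
have yr i : y i 0 * (y i 0)^* \is Num.real
  by rewrite ger0_real // mul_conjC_ge0.
exists (fun i => complex.Re (y i 0 * (y i 0)^*)) => [i|d].
  by rewrite -ler0c RRe_real // mul_conjC_ge0.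
rewrite /udiag !mulmxA -trmxC_mul -[_ *m U *m x]mulmxA -yE.
rewrite mul_mx_diag mxE rmorph_sum; apply: eq_bigr => i _ /=.
by rewrite !mxE rmorphM /= RRe_real // [_^* * _]mulrC -mulrA [_^* * _]mulrC.
Qed.

Lemma udiag_psd U d : (forall i, 0 <= d 0 i) -> psdmx (udiag U d).
Proof.
move=> d0; split=> [|x]; first exact/hermsymmxP/udiag_herm.
have [c c0 ->] := udiag_form U x.
by rewrite ler0c sumr_ge0 // => i _; rewrite mulr_ge0.
Qed.

Lemma udiag_unit U d :
  U \is unitarymx -> (forall i, 0 < d 0 i) -> udiag U d \in unitmx.
Proof.
move=> uU d0.
have dV : udiag U d *m udiag U (map_mx GRing.inv d) = 1%:M.
  rewrite (udiagM _ _ uU) -(udiag1 uU); congr udiag.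
  by apply/rowP => i; rewrite !mxE divff // gt_eqF.
exact: proj1 (mulmx1_unit dV).
Qed.

(** A diagonal matrix with positive entries is the square of the one with
    their square roots, so positivity is transported from the identity. *)
Lemma udiag_posdef U d :
  U \is unitarymx -> (forall i, 0 < d 0 i) -> posdefmx (udiag U d).
Proof.
move=> uU d0; have -> : udiag U d = (udiag U (map_mx Num.sqrt d))^t* *m 1%:M
    *m udiag U (map_mx Num.sqrt d).
  rewrite udiag_herm mulmx1 (udiagM _ _ uU); congr udiag.
  by apply/rowP => i; rewrite !mxE -expr2 sqr_sqrtr // ltW.
apply: posdef_congr; first by apply: udiag_unit => // i; rewrite mxE sqrtr_gt0.
split=> [|x x0]; first by apply/hermsymmxP; rewrite trmxC1.
by rewrite mulmx1 sqnorm_gt0.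
Qed.

Lemma herm_diagonalize A : A \is hermsymmx ->
  exists U d, U \is unitarymx /\ A = udiag U d.
Proof.
move=> hA; exists (spectralmx A), (map_mx (@complex.Re R) (spectral_diag A)).
split; first exact: spectral_unitarymx.
have /orthomx_spectralP {1}-> := hermitian_normalmx hA.
rewrite (invmx_unitary (spectral_unitarymx A)) /udiag.
suff <- : spectral_diag A = map_mx (real_complex R)
  (map_mx (@complex.Re R) (spectral_diag A)) by [].
apply/rowP => i; rewrite !mxE RRe_real //.
by have /mxOverP := hermitian_spectral_diag_real hA; apply.
Qed.

(** The vector v is the i-th vector of the orthonormal eigenbasis, i.e. the
    conjugate of the i-th row of U. *)
Lemma udiag_eigen U d i : U \is unitarymx ->
  let v := U^t* *m (delta_mx i 0 : 'cV[R[i]]_m) in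
  [/\ v != 0, udiag U d *m v = (d 0 i)%:C *: v
    & (v^t* *m udiag U d *m v) 0 0 = (d 0 i)%:C].
Proof.
move=> uU v; have Uv : U *m v = delta_mx i 0.
  by rewrite /v mulmxA (unitarymxP uU) mul1mx.
have v0 : v != 0.
  apply/eqP => v0; move: Uv; rewrite v0 mulmx0 => /colP/(_ i).
  by rewrite !mxE !eqxx => /esym/eqP; rewrite oner_eq0.
have ev : udiag U d *m v = (d 0 i)%:C *: v.
  rewrite /udiag -(mulmxA _ U v) Uv -mulmxA /v scalemxAr; congr (_ *m _).
  rewrite mul_diag_mx; apply/colP => j; rewrite !mxE.
  by have [->|] := eqVneq j i; rewrite ?mulr1 ?mulr0.
split=> //; rewrite -mulmxA ev -scalemxAr mxE.
have -> : v^t* *m v = (U *m v)^t* *m (U *m v).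
  by rewrite trmxC_mul -mulmxA (mulmxA (U^t*)) (unitarymxPV uU) mul1mx.
rewrite Uv mxE (bigD1 i) //= big1 => [|j /negPf ji].
  by rewrite !mxE !eqxx /= conjC1 mulr1 addr0 mulr1.
by rewrite !mxE ji mulr0.
Qed.

Lemma posdef_diagonalize A : posdefmx A ->
  exists U d, [/\ U \is unitarymx, forall i, 0 < d 0 i & A = udiag U d].
Proof.
case=> /herm_diagonalize[U [d [uU ->]]] pA; exists U, d; split=> // i.
by rewrite -ltcR; have [v0 _ <-] := udiag_eigen d i uU; apply: pA.
Qed.

Lemma posdef_unit A : posdefmx A -> A \in unitmx.
Proof. by move=> /posdef_diagonalize[U [d [uU d0 ->]]]; exact: udiag_unit. Qed.

(** Positivity is decided by the vectors of an orthonormal eigenbasis.  This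
    converts a Loewner inequality into a statement about the spectrum, which
    may be proved after a change of basis that is not unitary. *)
Lemma psd_eigen H : H \is hermsymmx ->
  (forall r v, v != 0 -> H *m v = r%:C *: v -> 0 <= r) -> psdmx H.
Proof.
move=> /herm_diagonalize[U [d [uU ->]]] pH; apply: udiag_psd => i.
by have [v0 ev _] := udiag_eigen d i uU; exact: pH v0 ev.
Qed.

(** * Real powers *)

(** If U^* diag(d) U = P^* diag(s) P, then W = P U^* satisfies
    s_i W_ij = W_ij d_j; hence s_i = d_j, and so f(s_i) = f(d_j), wherever
    W_ij is nonzero.  Powers can therefore be computed in any diagonalization,
    and all the laws of exponents reduce to those of real numbers. *)
Lemma mxpow_udiag U d p : U \is unitarymx ->
  mxpow (udiag U d) p = udiag U (map_mx (fun a => a `^ p) d).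
Proof.
move=> uU; set A := udiag U d.
have /hermitian_normalmx/orthomx_spectralP : A \is hermsymmx.
  exact/hermsymmxP/udiag_herm.
rewrite /mxpow; set P := spectralmx A; set s := spectral_diag A => eA.
have uP : P \is unitarymx by exact: spectral_unitarymx.
have iP := unitarymx_unit uP.
pose W := P *m U^t*.
have sW : diag_mx s *m W = W *m diag_mx (map_mx (real_complex R) d).
  have : P *m A *m U^t* = diag_mx s *m W.
    by rewrite eA !mulmxA (mulmxV iP) mul1mx.
  by rewrite /A /udiag => <-; rewrite !mulmxA (mulmxtVK _ uU).
have fW : diag_mx (map_mx (fun c => (complex.Re c `^ p)%:C) s) *m W =
    W *m diag_mx (map_mx (real_complex R) (map_mx (fun a => a `^ p) d)).
  apply/matrixP => i j; move/matrixP/(_ i j): sW.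
  rewrite !mul_diag_mx !mul_mx_diag; move: (W) => V; rewrite !mxE.
  move: (V i j) => w.
  have [->|w0] := eqVneq w 0; first by rewrite !mulr0 !mul0r.
  by rewrite mulrC => /(mulfI w0) ->; rewrite mulrC.
have {2}-> : P = W *m U by rewrite /W (mulmxKtV _ uU).
by rewrite mulmxA -(mulmxA (invmx P)) fW /W !mulmxA (mulVmx iP) mul1mx.
Qed.

Lemma mxpow0 A : posdefmx A -> mxpow A 0 = 1%:M.
Proof.
case/posdef_diagonalize=> U [d [uU d0 ->]].
rewrite (mxpow_udiag _ _ uU) -(udiag1 uU).
by congr udiag; apply/rowP => i; rewrite !mxE powRr0.
Qed.

Lemma mxpow1 A : posdefmx A -> mxpow A 1 = A.
Proof.
case/posdef_diagonalize=> U [d [uU d0 ->]]; rewrite (mxpow_udiag _ _ uU).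
by congr udiag; apply/rowP => i; rewrite !mxE powRr1 // ltW.
Qed.

Lemma mxpowD A p q : posdefmx A -> mxpow A (p + q) = mxpow A p *m mxpow A q.
Proof.
case/posdef_diagonalize=> U [d [uU d0 ->]].
rewrite !(mxpow_udiag _ _ uU) (udiagM _ _ uU).
congr udiag; apply/rowP => i; rewrite !mxE powRD //.
by rewrite (gt_eqF (d0 i)) implybT.
Qed.

Lemma mxpowM A p q : posdefmx A -> mxpow A (p * q) = mxpow (mxpow A p) q.
Proof.
case/posdef_diagonalize=> U [d [uU d0 ->]]; rewrite !(mxpow_udiag _ _ uU).
by congr udiag; apply/rowP => i; rewrite !mxE powRrM.
Qed.

Lemma mxpowZ r A p : 0 <= r -> posdefmx A ->
  mxpow (r%:C *: A) p = (r `^ p)%:C *: mxpow A p.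
Proof.
move=> r0 /posdef_diagonalize[U [d [uU d0 ->]]].
rewrite udiagZ !(mxpow_udiag _ _ uU) udiagZ.
by congr udiag; apply/rowP => i; rewrite !mxE powRM // ltW.
Qed.

Lemma mxpow_posdef A p : posdefmx A -> posdefmx (mxpow A p).
Proof.
case/posdef_diagonalize=> U [d [uU d0 ->]]; rewrite (mxpow_udiag _ _ uU).
by apply: udiag_posdef => // i; rewrite mxE powR_gt0.
Qed.

Lemma mxpow_herm A p : posdefmx A -> (mxpow A p)^t* = mxpow A p.
Proof. by move=> /(mxpow_posdef p)[/hermsymmxP]. Qed.

Lemma mxpow_form_continuous A x : posdefmx A -> exists2 f : R -> R,
  continuous f & forall p, (x^t* *m mxpow A p *m x) 0 0 = (f p)%:C.
Proof.
move=> /posdef_diagonalize[U [d [uU d0 ->]]]; have [c _ cE] := udiag_form U x.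
exists (fun p => \sum_i d 0 i `^ p * c i) => [p|p]; last first.
  rewrite (mxpow_udiag _ _ uU) cE; congr (_ %:C).
  by apply: eq_bigr => i _; rewrite mxE.
move: p; apply: continuous_big => [|i _ p]; first exact: add_continuous.
apply: cvgMl; rewrite /powR gt_eqF //.
by apply: continuous_comp; [exact: mulrr_continuous|exact: continuous_expR].
Qed.

(** * Hansen's inequality *)

(** Bisection: z always lies between two points of S whose distance is halved
    at each step. *)
Lemma midpoint_dense (S : R -> Prop) : S 0 -> S 1 ->
  (forall p q, S p -> S q -> S ((p + q) / 2)) ->
  forall z, 0 <= z <= 1 -> forall e, 0 < e -> exists2 p, S p & `|z - p| < e.
Proof.
move=> S0 S1 Smid z /andP[z0 z1] e e0.
have bisect n : exists p q, [/\ S p, S q, p <= z <= q & q - p = 2^-1 ^+ n].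
  elim: n => [|n [p [q [Sp Sq /andP[pz zq] qp]]]].
    by exists 0, 1; rewrite z0 z1 subr0 expr0.
  have [zm|mz] := leP z ((p + q) / 2).
    exists p, ((p + q) / 2); split=> //; first exact: Smid.
      by rewrite pz.
    by rewrite exprS -qp; lra.
  exists ((p + q) / 2), q; split=> //; first exact: Smid.
    by rewrite zq ltW.
  by rewrite exprS -qp; lra.
have [n ne] : exists n, 2^-1 ^+ n < e.
  exists (Num.truncn e^-1).+1.
  rewrite exprVn invf_plt ?posrE ?exprn_gt0 //.
  apply: lt_trans (truncnS_gt _) _.
  by rewrite -natrX ltr_nat ltn_expl.
have [p [q [Sp _ /andP[pz zq] qp]]] := bisect n.
exists p => //; rewrite ger0_norm ?subr_ge0 //; apply: le_lt_trans ne.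
by rewrite -qp lerB.
Qed.

(** C plays the role of an inverse square root of B: then T^* T <= B says that
    T C is a contraction. *)
Lemma loewner_contraction B C T u :
  loewner_ge B (T^t* *m T) -> C^t* *m B *m C = 1%:M ->
  ((T *m C *m u)^t* *m (T *m C *m u)) 0 0 <= (u^t* *m u) 0 0.
Proof.
move=> [_ /(_ (C *m u))] TB BC; rewrite -subr_ge0.
suff -> : (u^t* *m u) 0 0 - ((T *m C *m u)^t* *m (T *m C *m u)) 0 0 =
  ((C *m u)^t* *m (B - T^t* *m T) *m (C *m u)) 0 0 by [].
have -> : u^t* *m u = (C *m u)^t* *m B *m (C *m u).
  by rewrite -{1}[u^t*]mulmx1 -BC trmxC_mul !mulmxA.
have -> : (T *m C *m u)^t* *m (T *m C *m u) =
    (C *m u)^t* *m (T^t* *m T) *m (C *m u).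
  by rewrite !trmxC_mul !mulmxA.
by rewrite mulmxBr mulmxBl entryB.
Qed.

(** The inequality 0 <= |a - b|^2 suffices here in place of Cauchy-Schwarz. *)
Lemma inner_le1 (a b u : 'cV[R[i]]_m) r : u != 0 ->
  (a^t* *m a) 0 0 <= (u^t* *m u) 0 0 -> (b^t* *m b) 0 0 <= (u^t* *m u) 0 0 ->
  a^t* *m b = r%:C *: (u^t* *m u) -> r <= 1.
Proof.
move=> /sqnorm_gt0 + + + ab.
have ba : b^t* *m a = r%:C *: (u^t* *m u).
  by rewrite -[LHS]trmxCK trmxC_mul trmxCK ab trmxC_realZ trmxC_mul trmxCK.
have := sqnorm_ge0 (a - b); rewrite trmxCB mulmxBr !mulmxBl ab ba.
rewrite !entryB !entryZ.
move: ((a^t* *m a) 0 0) ((b^t* *m b) 0 0) ((u^t* *m u) 0 0) => x y N h N0 xN yN.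
rewrite -lecR -(ler_pM2r N0) mul1r.
have : 0 <= (1 - r%:C) * N *+ 2.
  apply: le_trans h _; rewrite -subr_ge0.
  have -> : (1 - r%:C) * N *+ 2 - (x - r%:C * N - (r%:C * N - y)) =
    (N - x) + (N - y) by ring.
  by rewrite addr_ge0 ?subr_ge0.
by rewrite pmulrn_lge0 // mulrBl mul1r subr_ge0.
Qed.

(** The product M = (Tp Cp)^* (Tq Cq) of two contractions is a contraction, but
    it need not be Hermitian.  It equals D (C N C) D^-1, so it has the spectrum
    of the Hermitian matrix C N C, whose eigenvalues are thus at most 1. *)
Lemma contraction_product_le1 N C D (Cp Cq Tp Tq : 'M[R[i]]_m) :
  D \in unitmx -> C^t* = C -> N^t* = N ->
  D *m C = Cp^t* -> Cq *m D = C -> Tp^t* *m Tq = N ->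
  (forall u, ((Tp *m Cp *m u)^t* *m (Tp *m Cp *m u)) 0 0 <= (u^t* *m u) 0 0) ->
  (forall u, ((Tq *m Cq *m u)^t* *m (Tq *m Cq *m u)) 0 0 <= (u^t* *m u) 0 0) ->
  psdmx (1%:M - C *m N *m C).
Proof.
move=> uD hC hN CpE CqE NE cp cq.
have hH : (C *m N *m C)^t* = C *m N *m C by rewrite !trmxC_mul hC hN mulmxA.
apply: psd_eigen => [|r v v0].
  by apply/hermsymmxP; rewrite trmxCB hH trmxC1.
rewrite mulmxBl mul1mx => ev.
have Hv : C *m N *m C *m v = (1 - r)%:C *: v.
  by rewrite rmorphB scalerBl /= scale1r -ev opprB addrC subrK.
pose u := D *m v.
have u0 : u != 0.
  by apply: contraNneq v0 => u0; rewrite -(mulKmx uD v) -/u u0 mulmx0.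
suff : 1 - r <= 1 by rewrite gerBl.
apply: inner_le1 u0 (cp u) (cq u) _.
have -> : Tq *m Cq *m u = Tq *m C *m v by rewrite /u -CqE !mulmxA.
by rewrite !trmxC_mul -CpE scalemxAr scalemxAr -Hv -NE /u !mulmxA.
Qed.

(** In the notation of [contraction_product_le1], with s = (p + q) / 2:
    Tp = Y^(p/2) K and Cp = B^(-p/2), likewise for q, while C = B^(-s/2) and
    D = B^((q-p)/4).  The hypotheses say that Tp Cp and Tq Cq are
    contractions, and conjugating the conclusion by C makes it C N C <= 1, for
    N = K^* Y^s K. *)
Lemma hansen_midpoint K Y p q : K \in unitmx -> posdefmx Y ->
  let B := K^t* *m Y *m K in
  loewner_ge (mxpow B p) (K^t* *m mxpow Y p *m K) ->
  loewner_ge (mxpow B q) (K^t* *m mxpow Y q *m K) ->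
  loewner_ge (mxpow B ((p + q) / 2)) (K^t* *m mxpow Y ((p + q) / 2) *m K).
Proof.
move=> uK pdY B Bp Bq; have pdB : posdefmx B by exact: posdef_congr.
set s := (p + q) / 2; set N := K^t* *m mxpow Y s *m K.
have hN : N^t* = N by apply/congr_herm/mxpow_herm.
pose T t := mxpow Y (t / 2) *m K.
have TE a b : (T a)^t* *m T b = K^t* *m mxpow Y ((a + b) / 2) *m K.
  rewrite /T trmxC_mul (mxpow_herm _ pdY) mulrDl (mxpowD _ _ pdY).
  by move: (mxpow Y _) (mxpow Y _) => P Q; rewrite !mulmxA.
have BE t : (mxpow B (- (t / 2)))^t* *m mxpow B t *m mxpow B (- (t / 2)) = 1%:M.
  rewrite (mxpow_herm _ pdB) -!(mxpowD _ _ pdB) -(mxpow0 pdB).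
  by congr mxpow; lra.
have Tcontr t : loewner_ge (mxpow B t) (K^t* *m mxpow Y t *m K) -> forall u,
    ((T t *m mxpow B (- (t / 2)) *m u)^t* *m
       (T t *m mxpow B (- (t / 2)) *m u)) 0 0 <= (u^t* *m u) 0 0.
  move=> Bt u; apply: loewner_contraction (BE t).
  by rewrite TE (_ : (t + t) / 2 = t) //; lra.
have psdH : psdmx (1%:M - mxpow B (- (s / 2)) *m N *m mxpow B (- (s / 2))).
  apply: contraction_product_le1 hN _ _ (TE p q) (Tcontr p Bp) (Tcontr q Bq).
  - exact/posdef_unit/(mxpow_posdef ((q - p) / 4) pdB).
  - exact: mxpow_herm.
  - rewrite (mxpow_herm _ pdB) -(mxpowD _ _ pdB).
    by congr mxpow; rewrite /s; lra.
  - by rewrite -(mxpowD _ _ pdB); congr mxpow; rewrite /s; lra.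
rewrite (splitr s) (mxpowD _ _ pdB).
apply: loewner_conj_inv psdH; first exact: mxpow_herm.
by rewrite -(mxpowD _ _ pdB) subrr (mxpow0 pdB).
Qed.

(** Hansen's inequality.  It is an equality at z = 1, reads K^* K <= 1 at
    z = 0, and passes to midpoints; continuity in the exponent then gives all
    z in between. *)
Lemma hansen K Y z : K \in unitmx -> psdmx (1%:M - K^t* *m K) -> posdefmx Y ->
  0 <= z <= 1 ->
  loewner_ge (mxpow (K^t* *m Y *m K) z) (K^t* *m mxpow Y z *m K).
Proof.
move=> uK cK pdY z01; set B := _ *m K.
have pdB : posdefmx B by exact: posdef_congr.
pose S p := loewner_ge (mxpow B p) (K^t* *m mxpow Y p *m K).
have S0 : S 0 by rewrite /S (mxpow0 pdB) (mxpow0 pdY) mulmx1.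
have S1 : S 1.
  by rewrite /S (mxpow1 pdB) (mxpow1 pdY) /loewner_ge subrr; exact: psd0.
have Smid p q : S p -> S q -> S ((p + q) / 2) by exact: hansen_midpoint.
split=> [|x].
  apply/hermsymmxP; rewrite trmxCB (mxpow_herm _ pdB) congr_herm //.
  exact: mxpow_herm.
have [f cf fE] := mxpow_form_continuous x pdB.
have [g cg gE] := mxpow_form_continuous (K *m x) pdY.
have fgE p : (x^t* *m (mxpow B p - K^t* *m mxpow Y p *m K) *m x) 0 0 =
    (f p - g p)%:C.
  rewrite rmorphB /= -fE -gE; move: (mxpow B p) (mxpow Y p) => P Q.
  rewrite trmxC_mul mulmxBr mulmxBl !mulmxA.
  by rewrite entryB.
rewrite fgE ler0c leNgt; apply/negP => fg0.
have cfg : (f p - g p @[p --> z] --> f z - g z)%classic.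
  by apply: cvgB; [exact: cf|exact: cg].
have nz : nbhs z (fun p => f p - g p < 0) by exact: cvgr_lt cfg _ fg0.
have [e /= e0 ze] : nbhs_ball z (fun p => f p - g p < 0) by exact/nbhs_ballP.
have [p Sp pz] := midpoint_dense S0 S1 Smid z01 e0.
have := ze p pz; have [_ /(_ x)] := Sp.
by rewrite fgE ler0c => /le_gtF ->.
Qed.

(** Apply Hansen's inequality to the contraction r^(-1/2) K. *)
Lemma hansen_scaled K Y r z : 0 < r ->
  K \in unitmx -> psdmx (r%:C *: 1%:M - K^t* *m K) -> posdefmx Y ->
  0 <= z <= 1 ->
  loewner_ge (mxpow (K^t* *m Y *m K) z)
    ((r `^ (z - 1))%:C *: (K^t* *m mxpow Y z *m K)).
Proof.
move=> r0 uK cK pdY z01; pose k := r `^ (- 2^-1).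
have k0 : 0 < k by exact: powR_gt0.
have kk : k * k = r^-1.
  rewrite -(powR_inv1 (ltW r0)) /k -powRD ?(gt_eqF r0) ?implybT //.
  by congr powR; lra.
have kK G : (k%:C *: K)^t* *m G *m (k%:C *: K) = (r^-1)%:C *: (K^t* *m G *m K).
  by rewrite trmxC_realZ -!scalemxAl -scalemxAr scalerA -rmorphM kk.
have kK1 : (k%:C *: K)^t* *m (k%:C *: K) = (r^-1)%:C *: (K^t* *m K).
  by have := kK 1%:M; rewrite !mulmx1.
have pdB : posdefmx (K^t* *m Y *m K) by exact: posdef_congr.
have rV0 : 0 <= r^-1 by rewrite invr_ge0 ltW.
have ukK : k%:C *: K \in unitmx.
  by rewrite unitmxZ // unitfE (inj_eq (@complexI R)) gt_eqF.
have rVr : (r^-1)%:C * r%:C = 1 :> R[i] by rewrite -rmorphM mulVf ?gt_eqF.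
have rzV : (r `^ z)%:C * (r^-1 `^ z)%:C = 1 :> R[i].
  by rewrite -rmorphM -(powRM z (ltW r0) rV0) divff ?gt_eqF // powR1.
have rz1 : (r `^ z)%:C * (r^-1)%:C = (r `^ (z - 1))%:C :> R[i].
  by rewrite -rmorphM powRB ?(gt_eqF r0) ?implybT // powRr1 // ltW.
have ckK : psdmx (1%:M - (k%:C *: K)^t* *m (k%:C *: K)).
  by have := psdZ rV0 cK; rewrite kK1 scalerBr scalerA rVr scale1r.
have := hansen ukK ckK pdY z01.
rewrite !kK (mxpowZ _ rV0 pdB).
move: (mxpow _ z) (_ *m K) => P Q /(psdZ (powR_ge0 r z)).
by rewrite scalerBr !scalerA rzV rz1 scale1r.
Qed.

(** * Monotonicity of the square root and convexity of the square *)

(** Operator monotonicity of the square root.  If (P - Q) v = r v with r < 0,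
    then Q v = P v - r v, so |Q v|^2 = |P v|^2 - 2 r (v, P v) + r^2 |v|^2
    exceeds |P v|^2, contrary to Q^2 <= P^2. *)
Lemma psd_sqr_le P Q : psdmx P -> Q \is hermsymmx ->
  loewner_ge (P *m P) (Q *m Q) -> loewner_ge P Q.
Proof.
move=> [/hermsymmxP hP pP] /hermsymmxP hQ [_ PQ]; apply: psd_eigen => [|r v v0].
  by apply/hermsymmxP; rewrite trmxCB hP hQ.
rewrite mulmxBl => ev; rewrite leNgt; apply/negP => r0.
have Qv : Q *m v = P *m v - r%:C *: v by rewrite -ev opprB addrC subrK.
have vP : v^t* *m P = (P *m v)^t* by rewrite trmxC_mul hP.
have vQ : v^t* *m Q = (P *m v)^t* - r%:C *: v^t*.
  by rewrite -trmxC_realZ -trmxCB -Qv trmxC_mul hQ.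
have := PQ v; rewrite mulmxBr mulmxBl !mulmxA vP vQ -!mulmxA Qv.
rewrite !mulmxBl !mulmxBr -!scalemxAl -!scalemxAr -vP !mulmxA.
have E (T M N : 'M[R[i]]_1) : (T - r%:C *: M -
    (r%:C *: M - r%:C *: (r%:C *: N))) 0 0 =
  T 0 0 - r%:C * (M 0 0 + M 0 0 - r%:C * N 0 0).
  by rewrite !(entryB, entryZ); ring.
rewrite entryB E subKr; have := pP v; have := sqnorm_gt0 v0.
move: (_ 0 0) (_ 0 0) => N M N0 M0.
have r0' : r%:C < 0 :> R[i] by rewrite -(ltcR r 0) in r0.
rewrite nmulr_rge0 // lt_geF //.
by rewrite ltr_wpDl ?addr_ge0 // oppr_gt0 nmulr_rlt0.
Qed.

(** Conjugating the hypothesis by Y turns its right-hand side into the square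
    (k Y S Y)^2, to which the monotonicity of the square root applies; Y is then
    removed by conjugating with its inverse V. *)
Lemma loewner_sqrt X Y V P S (k : R) :
  Y^t* = Y -> V^t* = V -> S^t* = S -> V *m Y = 1%:M -> psdmx P ->
  P *m P = Y *m X *m Y -> loewner_ge X ((k * k)%:C *: (S *m (Y *m Y) *m S)) ->
  loewner_ge (V *m P *m V) (k%:C *: S).
Proof.
move=> hY hV hS VY psdP PE kSX; have YV := mulmx1C VY.
have PQ : loewner_ge P (k%:C *: (Y *m S *m Y)).
  apply: psd_sqr_le psdP _ _.
    by apply/hermsymmxP; rewrite trmxC_realZ !trmxC_mul hY hS mulmxA.
  have := psd_congr Y kSX; rewrite hY /loewner_ge PE.
  by rewrite mulmxBr mulmxBl -!(scalemxAl, scalemxAr) scalerA -rmorphM !mulmxA.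
have := psd_congr V PQ; rewrite hV mulmxBr mulmxBl -!(scalemxAl, scalemxAr).
by rewrite !mulmxA VY mul1mx -!mulmxA YV mulmx1.
Qed.

Lemma subr_subrACA (V : zmodType) (a b c d : V) :
  a - b - (c - d) = a - c - b + d.
Proof. by rewrite opprB addrA [LHS]addrAC; congr (_ + _); rewrite addrAC. Qed.

(** Operator convexity of B |-> B G B, in the form of a variance: the
    difference of the two sides is the mean of the (B_j - S) G (B_j - S). *)
Lemma psd_variance (n : nat) (w : 'I_n -> R) (B : 'I_n -> 'M[R[i]]_m) G :
  (forall j, 0 <= w j) -> \sum_j w j = 1 -> (forall j, (B j)^t* = B j) ->
  psdmx G -> let S := \sum_j (w j)%:C *: B j in
  loewner_ge (\sum_j (w j)%:C *: (B j *m G *m B j)) (S *m G *m S).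
Proof.
move=> w0 w1 hB pG S.
have hS : S^t* = S.
  exact: herm_sum.
rewrite /loewner_ge.
have <- : \sum_j (w j)%:C *: ((B j - S)^t* *m G *m (B j - S)) =
  \sum_j (w j)%:C *: (B j *m G *m B j) - S *m G *m S.
  have E j : (w j)%:C *: ((B j - S)^t* *m G *m (B j - S)) =
      (w j)%:C *: (B j *m G *m B j) - ((w j)%:C *: B j) *m G *m S
      - S *m G *m ((w j)%:C *: B j) + (w j)%:C *: (S *m G *m S).
    rewrite trmxCB hB hS; move: (S) (B j) (w j)%:C => T C c.
    rewrite mulmxBr !mulmxBl -scalemxAr -!scalemxAl !scalerBr.
    exact: subr_subrACA.
  rewrite (eq_bigr _ (fun j _ => E j)) big_split !sumrB /=.
  rewrite -scaler_suml -rmorph_sum w1 scale1r -!mulmx_suml -mulmx_sumr -/S.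
  by rewrite subrK.
by apply: psd_sum => j; apply: psdZ (w0 j) _; exact: psd_congr.
Qed.

(** * The largest eigenvalue *)

Lemma udiag_eigenvalueP U d r : U \is unitarymx ->
  eigenvalue (udiag U d) r%:C -> exists i, d 0 i = r.
Proof.
move=> uU /eigenvalueP[v ev v0].
have w0 : v *m U^t* != 0.
  by apply: contraNneq v0 => w0; rewrite -(mulmxKtV v uU) // w0 mul0mx.
have : v *m U^t* *m diag_mx (map_mx (real_complex R) d) = r%:C *: (v *m U^t*).
  by rewrite scalemxAl -ev /udiag !mulmxA (mulmxtVK _ uU).
rewrite mul_mx_diag; move: (v *m _) w0 => y /rV0Pn[i yi0] /rowP/(_ i).
rewrite !mxE mulrC => /(mulIf yi0)/complexI <-.
by exists i.
Qed.

(** The supremum that defines the largest eigenvalue is over a set bounded by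
    the sum of the |d_j|, since every eigenvalue is one of the d_j. *)
Lemma lambda1_ge U d i : U \is unitarymx -> d 0 i <= lambda1 (udiag U d).
Proof.
move=> uU; apply: ub_le_sup.
  exists (\sum_j `|d 0 j|) => _ /(udiag_eigenvalueP uU)[j <-].
  by rewrite (bigD1 j) //= ler_wpDr ?ler_norm // sumr_ge0.
apply/eigenvalueP; exists (row i U).
  rewrite -row_mul /udiag !mulmxA (unitarymxP uU) mul1mx mul_diag_mx.
  by apply/rowP => j; rewrite !mxE.
apply/eqP => Ui0; have := unitarymxP uU => /row_matrixP/(_ i).
rewrite row_mul Ui0 mul0mx => /rowP/(_ i); rewrite !mxE eqxx => /esym/eqP.
by rewrite oner_eq0.
Qed.

Lemma lambda1_gt0 A : (0 < m)%N -> posdefmx A -> 0 < lambda1 A.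
Proof.
move=> m0 /posdef_diagonalize[U [d [uU d0 ->]]].
exact: lt_le_trans (d0 (Ordinal m0)) (lambda1_ge _ _ uU).
Qed.

Lemma mxpow_le_lambda1 A r p : 0 <= p -> posdefmx A -> lambda1 A <= r ->
  loewner_ge ((r `^ p)%:C *: 1%:M) (mxpow A p).
Proof.
move=> p0 /posdef_diagonalize[U [d [uU d0 ->]]] lr.
rewrite (mxpow_udiag _ _ uU) -(udiag1 uU) udiagZ /loewner_ge udiagB.
apply: udiag_psd => i.
have dr : d 0 i <= r by exact: le_trans (lambda1_ge _ _ uU) lr.
rewrite !mxE mulr1 subr_ge0 ge0_ler_powR // nnegrE ?ltW //.
exact: lt_le_trans (d0 i) dr.
Qed.

(** * The Rényi power mean *)

(** Bound each term of the equation for X by Hansen's inequality with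
    K = A_j^a, where K^2 <= L^(2 a); then bound the mean of the
    A_j^a X^t A_j^a from below by convexity. *)
Lemma renyi_mean_ge (n : nat) (A : 'I_n -> 'M[R[i]]_m) (w : 'I_n -> R) X t z :
  (0 < m)%N -> (0 < n)%N ->
  (forall j, posdefmx (A j)) -> pos_prob_vector w ->
  0 < t -> t <= z -> z < 1 -> is_renyi_power_mean t z w A X ->
  let k := lambda_max A `^ (- ((1 - t) * (1 - z) / (2 * z))) in
  let S := \sum_j (w j)%:C *: mxpow (A j) ((1 - t) / (2 * z)) in
  loewner_ge X ((k * k)%:C *: (S *m mxpow X t *m S)).
Proof.
move=> m0 n0 pdA [w0 w1] t0 tz z1 [pdX XE] k S.
have z0 : 0 < z by exact: lt_le_trans tz.
set a := (1 - t) / (2 * z) in S XE *.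
have a0 : 0 <= a by rewrite divr_ge0 ?mulr_ge0 ?subr_ge0 ?ltW //; lra.
set L := lambda_max A in k *.
have lL j : lambda1 (A j) <= L by exact: le_bigmax.
have L0 : 0 < L.
  exact: lt_le_trans (lambda1_gt0 m0 (pdA (Ordinal n0))) (lL _).
have kk : k * k = (L `^ (2 * a)) `^ (z - 1).
  rewrite /k -powRD ?(gt_eqF L0) ?implybT // -powRrM; congr powR.
  by rewrite /a; field; rewrite gt_eqF.
have Xt : mxpow (mxpow X (t / z)) z = mxpow X t.
  by rewrite -(mxpowM _ _ pdX); congr mxpow; rewrite mulfVK ?gt_eqF.
have Aa j := mxpow_posdef a (pdA j).
have hA j := mxpow_herm a (pdA j).
have hansenA j : loewner_ge
    (mxpow (mxpow (A j) a *m mxpow X (t / z) *m mxpow (A j) a) z)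
    ((k * k)%:C *: (mxpow (A j) a *m mxpow X t *m mxpow (A j) a)).
  have La : psdmx ((L `^ (2 * a))%:C *: 1%:M -
      (mxpow (A j) a)^t* *m mxpow (A j) a).
    have aa : a + a = 2 * a by ring.
    rewrite hA -(mxpowD _ _ (pdA j)) aa.
    by apply: mxpow_le_lambda1 (pdA j) (lL j); rewrite mulr_ge0.
  have z01 : 0 <= z <= 1 by rewrite !ltW.
  have := hansen_scaled (powR_gt0 _ L0) (posdef_unit (Aa j)) La
    (mxpow_posdef (t / z) pdX) z01.
  by rewrite Xt -kk hA.
apply: (@loewner_ge_trans ((k * k)%:C *:
    \sum_j (w j)%:C *: (mxpow (A j) a *m mxpow X t *m mxpow (A j) a))).
  rewrite /loewner_ge {1}XE scaler_sumr -sumrB; apply: psd_sum => j.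
  have := psdZ (ltW (w0 j)) (hansenA j).
  by rewrite scalerBr !scalerA [(w j)%:C * _]mulrC.
rewrite /loewner_ge -scalerBr; apply: psdZ; first by rewrite mulr_ge0 ?powR_ge0.
apply: psd_variance w1 hA (posdef_psd (mxpow_posdef t pdX)) => j.
exact: ltW.
Qed.

End PositiveMatrices.

Theorem theorem5p4 (R : realType) (m n : nat)
    (A : 'I_n -> 'M[R[i]]_m) (w : 'I_n -> R) (t z : R) (X : 'M[R[i]]_m) :
  (1 <= m)%N -> (1 <= n)%N ->
  (forall j, posdefmx (A j)) ->
  pos_prob_vector w ->
  0 < t -> t <= z -> z < 1 ->
  is_renyi_power_mean t z w A X ->
  loewner_ge (mxpow X ((1 - t) / 2))
    ((lambda_max A `^ (- ((1 - t) * (1 - z) / (2 * z))))%:C *: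
       \sum_(j < n) (w j)%:C *: mxpow (A j) ((1 - t) / (2 * z))).
Proof.
move=> m0 n0 pdA pw t0 tz z1 rX.
have pdX : posdefmx X by case: rX.
have := renyi_mean_ge m0 n0 pdA pw t0 tz z1 rX.
set k := _ `^ _; set S := \sum_j _.
have hS : (S^t*)%sesqui = S by apply: herm_sum => j; exact: mxpow_herm (pdA j).
rewrite {1}(splitr t) (mxpowD _ _ pdX) => kSX.
have PE : mxpow X ((1 + t) / 2) *m mxpow X ((1 + t) / 2) =
    mxpow X (t / 2) *m X *m mxpow X (t / 2).
  transitivity (mxpow X (1 + t)).
    by rewrite -(mxpowD _ _ pdX); congr mxpow; lra.
  have -> : 1 + t = t / 2 + 1 + t / 2 by lra.
  by rewrite 2!(mxpowD _ _ pdX) (mxpow1 pdX).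
have VY : mxpow X (- (t / 2)) *m mxpow X (t / 2) = 1%:M.
  by rewrite -(mxpowD _ _ pdX) addNr (mxpow0 pdX).
have := loewner_sqrt (mxpow_herm _ pdX) (mxpow_herm _ pdX) hS VY
  (posdef_psd (mxpow_posdef _ pdX)) PE kSX.
rewrite -2!(mxpowD _ _ pdX).
by have -> : - (t / 2) + (1 + t) / 2 + - (t / 2) = (1 - t) / 2 by lra.
Qed.
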